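(* Let $n\ge 2$ and let $X\subset\mathbb{R}^2$ be a finite $D_n$-symmetric set with at least two points. Then $X$ is the disjoint union of $a$ one-point sets, $b$ regular $n$-gons and $c$ semiregular $2n$-gons, where $a\in\{0,1\}$ and $b+c>0$.
   Context: $D_n=\langle r,s\rangle$ is the dihedral group with $2n$ elements, acting on $\mathbb{R}^2$ by the standard representation $\sigma$: $\sigma(r)=\begin{pmatrix}\cos 2\pi/n&-\sin2\pi/n\\ \sin2\pi/n&\cos2\pi/n\end{pmatrix}$, $\sigma(s)=\begin{pmatrix}-1&0\\0&1\end{pmatrix}$. A set $X\subset\mathbb{R}^2$ is $D_n$-symmetric if $\sigma(g)X=X$ for all $g\in D_n$. ''Regular $n$-gon'' and ''semiregular $2n$-gon'' refer to sets of vertices. A regular $2$-gon means a pair of points symmetric with respect to the center. A semiregular $2n$-gon is a set of $2n$ points that is a single $D_n$-orbit, i.e. the orbit of a point lying on none of the $n$ reflection lines (the vertices of a $2n$-gon inscribed in a circle, invariant under $D_n$, whose side lengths alternate between two possibly equal values; a rectangle when $n=2$). *)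

(* Defs.v *)
From HB Require Import structures.
From mathcomp Require Import all_boot all_order all_algebra all_fingroup.
From mathcomp Require Import extremal mxrepresentation.
From mathcomp Require Import boolp classical_sets functions cardinality.
From mathcomp Require Import reals trigo.

Set Implicit Arguments.
Unset Strict Implicit.
Unset Printing Implicit Defensive.

Import Order.TTheory GRing.Theory Num.Theory.
Local Open Scope classical_set_scope.
Local Open Scope ring_scope.

(* In MathComp the subscript of 'D_m is the order of the group. *)
Definition dihedral (n : nat) : finGroupType := 'D_(n.*2).

(* Points of the plane are column vectors, so that matrices act on the left. *)
Definition rotation_mx (R : realType) (t : R) : 'M[R]_2 :=
  (block_mx (cos t)%:M (- sin t)%:M
            (sin t)%:M (cos t)%:M : 'M_(1 + 1)).

Definition reflection_mx (R : realType) : 'M[R]_2 :=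
  (block_mx (-1)%:M 0
            0       1%:M : 'M_(1 + 1)).

Definition dihedral_generators (n : nat) (r s : dihedral n) : Prop :=
  [/\ <<[set r; s]%SET>>%g = [set: dihedral n]%SET,
      (r ^+ n = 1)%g, (s ^+ 2 = 1)%g & (r ^ s = r^-1)%g].

(* A representation is determined by its values on generators. *)
Definition standard_repr (R : realType) (n : nat) (r s : dihedral n)
    (sigma : mx_representation R [set: dihedral n]%G 2) : Prop :=
  sigma r = rotation_mx (2 * pi / n%:R) /\ sigma s = reflection_mx R.

Section Polygons.
Variables (R : realType) (n : nat).
Variable sigma : mx_representation R [set: dihedral n]%G 2.
Implicit Types X P : set 'cV[R]_2.

Definition dihedral_symmetric X : Prop :=
  forall g : dihedral n, [set sigma g *m x | x in X] = X.

Definition dihedral_orbit (x : 'cV[R]_2) : set 'cV[R]_2 :=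
  [set sigma g *m x | g in [set: dihedral n]].

Definition one_point P : Prop := exists x, P = [set x].

(* The vertices of a regular n-gon centred at the origin; for n = 2 this is
   a pair {v, -v} with v != 0. *)
Definition regular_ngon P : Prop :=
  exists2 v : 'cV[R]_2, v != 0 &
    P = [set rotation_mx (2 * pi * k%:R / n%:R) *m v | k in `I_n].

Definition semiregular_2ngon P : Prop :=
  (P #= `I_(n.*2))%card /\ exists x, P = dihedral_orbit x.

(* Besides being regular n-gons, semiregular 2n-gons or single points, the
   pieces are required to be symmetric for the same action as X. Without this,
   any semiregular 2n-gon could be split further, into two regular n-gons
   exchanged by the reflections. *)
Definition polygon_decomposition X (a b c : nat) : Prop :=
  exists F : 'I_a + 'I_b + 'I_c -> set 'cV[R]_2,
    [/\ X = \bigcup_t F t,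
        trivIset setT F,
        forall t, dihedral_symmetric (F t)
      & [/\ forall i : 'I_a, one_point (F (inl (inl i))),
            forall j : 'I_b, regular_ngon (F (inl (inr j)))
          & forall k : 'I_c, semiregular_2ngon (F (inr k))]].

End Polygons.

(* Main.v *)
Require Import Defs.
From mathcomp Require Import all_boot all_order all_algebra all_fingroup.
From mathcomp Require Import extremal mxrepresentation.
From mathcomp Require Import boolp classical_sets functions cardinality.
From mathcomp Require Import reals trigo.
From mathcomp Require Import ring lra.

(** X is the disjoint union of its finitely many orbits, and the origin is a
    fixed point. Let x be a nonzero point. If its stabilizer is trivial, its
    orbit has 2n points. Otherwise the stabilizer contains some h <> 1; a
    nontrivial rotation fixes only the origin, so h = r^i s, and then r^k s
    acts on x as r^(k-i), so that the orbit of x is already its orbit under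
    the rotations. *)

Import Order.TTheory GRing.Theory Num.Theory.

(** * Rotation matrices and their fixed vectors *)

Section Rotation.
Local Open Scope ring_scope.
Variable R : realType.
Implicit Types (t u : R) (x : 'cV[R]_2).

Lemma rotation_mx0 : rotation_mx 0 = 1%:M :> 'M[R]_2.
Proof.
by rewrite /rotation_mx cos0 sin0 oppr0 !raddf0 -scalar_mx_block.
Qed.

Lemma rotation_mxD t u : rotation_mx (t + u) = rotation_mx t *m rotation_mx u.
Proof.
rewrite /rotation_mx; apply: etrans (esym (@mulmx_block R 1 1 1 1 1 1 _ _ _ _ _ _ _ _)).
rewrite -!scalar_mxM -!raddfD cosD sinD.
by congr block_mx; congr _%:M; ring.
Qed.

(** Pairing the equation [rotation_mx t *m x = x] with x itself cancels the sine terms and leaves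
    (cos t - 1) |x|^2 = 0. *)
Lemma rotation_mx_fix t x : x != 0 -> rotation_mx t *m x = x -> cos t = 1.
Proof.
rewrite -[x](vsubmxK (x : 'cV_(1 + 1))) => x0 fx.
have := etrans (esym (@mul_block_col R 1 1 1 1 1 _ _ _ _ _ _)) fx.
move=> /eq_col_mx[]; rewrite !mul_scalar_mx.
move=> /(congr1 (fun M : 'M_1 => M 0 0)) + /(congr1 (fun M : 'M_1 => M 0 0)).
move: x0; rewrite !mxE; set a := x _ _; set b := x _ _ => x0 ea eb.
(* The two coordinate equations [ea] and [eb], weighted by a and b and added. *)
have : (cos t - 1) * (a ^+ 2 + b ^+ 2) = 0.
  have ->: (cos t - 1) * (a ^+ 2 + b ^+ 2) =
    (cos t * a + - sin t * b - a) * a + (sin t * a + cos t * b - b) * b by ring.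
  by rewrite ea eb !subrr !mul0r addr0.
move=> /eqP; rewrite mulf_eq0 subr_eq0 => /orP[/eqP //|].
rewrite paddr_eq0 ?sqr_ge0// !sqrf_eq0 => /andP[/eqP a0 /eqP b0].
case/eqP: x0; apply: etrans (@col_mx0 R 1 1 1).
by congr col_mx; apply/matrixP => i j; rewrite !ord1 !mxE.
Qed.

(** Half-angle formula: cos t = 1 - 2 sin(t/2)^2, and t/2 lies strictly between 0 and pi, where the
    sine is positive. *)
Lemma cos_lt1 t : 0 < t < 2 * pi -> cos t < 1.
Proof.
move=> /andP[t0 t2]; have -> : t = (t / 2) *+ 2 by rewrite -mulr_natr; field.
rewrite cos_mulr2n cos2sin2.
have : 0 < sin (t / 2) ^+ 2 by rewrite exprn_gt0// sin_gt0_pi//; apply/andP; split; lra.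
lra.
Qed.

End Rotation.

(** Supplies the ordinal-indexed families of a decomposition; injectivity is what later makes the
    pieces disjoint. *)
Lemma finite_enum (T : eqType) (A : set T) : finite_set A ->
  exists m (f : 'I_m -> T), injective f /\ range f = A.
Proof.
move=> /finite_seqP[q0 ->]; have [q qu qq] : exists2 q, uniq q & q =i q0.
  by exists (undup q0); [exact: undup_uniq | exact: mem_undup].
exists (size q), (tnth (in_tuple q)); split; first exact/tuple_uniqP.
apply/seteqP; split=> [_ [i _ <-]|x] /=; rewrite -qq; first exact: mem_tnth.
by move=> /(tnthP (in_tuple q))[i ->]; exists i.
Qed.

Lemma card_eq_fintype (T : finType) : ([set: T]%classic #= `I_#|T|)%card.
Proof.
rewrite card_eq_sym; apply: (card_eq_trans card_II).
have <- : (enum_val @` [set: 'I_#|T|] = [set: T])%classic.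
  by apply/seteqP; split=> // x _; exists (enum_rank x); rewrite ?enum_rankK.
rewrite card_eq_sym; apply: inj_card_eq => i j _ _; exact: enum_val_inj.
Qed.

(** * Orbits of the dihedral action *)

Section Orbit.
Local Open Scope classical_set_scope.
Local Open Scope ring_scope.
Variables (R : realType) (n : nat).
Variable sigma : mx_representation R [set: dihedral n]%G 2.
Implicit Types (x y : 'cV[R]_2) (g h : dihedral n).

Lemma dihedral_reprM g h : sigma (g * h)%g = sigma g *m sigma h.
Proof. by rewrite repr_mxM ?inE. Qed.

Lemma dihedral_orbit_refl x : dihedral_orbit sigma x x.
Proof. by exists 1%g => //; rewrite repr_mx1 mul1mx. Qed.

Lemma dihedral_orbit_eq x y :
  dihedral_orbit sigma x y -> dihedral_orbit sigma y = dihedral_orbit sigma x.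
Proof.
move=> [g _ <-]; apply/seteqP; split=> _ [h _ <-].
  by exists (h * g)%g => //; rewrite dihedral_reprM mulmxA.
by exists (h * g^-1)%g => //; rewrite mulmxA -dihedral_reprM mulgKV.
Qed.

Lemma dihedral_orbit_sym x : dihedral_symmetric sigma (dihedral_orbit sigma x).
Proof.
move=> g; apply/seteqP; split=> [_ [_ [h _ <-] <-]|_ [h _ <-]].
  by exists (g * h)%g => //; rewrite dihedral_reprM mulmxA.
exists (sigma (g^-1 * h)%g *m x); first by exists (g^-1 * h)%g.
by rewrite mulmxA -dihedral_reprM mulKVg.
Qed.

Lemma dihedral_orbit_sub (X : set 'cV[R]_2) x :
  dihedral_symmetric sigma X -> X x -> dihedral_orbit sigma x `<=` X.
Proof. by move=> Xs Xx _ [g _ <-]; rewrite -(Xs g); exists x. Qed.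

Lemma dihedral_orbit0 : dihedral_orbit sigma 0 = [set 0].
Proof.
apply/seteqP; split=> [_ [g _ <-]|_ ->]; first by rewrite mulmx0.
exact: dihedral_orbit_refl.
Qed.

(** With trivial stabilizer the orbit map g -> [sigma g *m x] is injective, so the orbit is
    equinumerous with the group, whose order is 2n. *)
Lemma free_dihedral_orbit x : (1 < n)%N ->
  (forall g, sigma g *m x = x -> g = 1%g) ->
  semiregular_2ngon sigma (dihedral_orbit sigma x).
Proof.
move=> n1 fx; split; last by exists x.
apply: (card_eq_trans (B := [set: dihedral n])).
  apply: inj_card_eq => g h _ _ e.
  apply/(mulgI h^-1)%g; rewrite mulVg; apply: fx.
  by rewrite dihedral_reprM -mulmxA e mulmxA -dihedral_reprM mulVg repr_mx1 mul1mx.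
rewrite -(card_dihedral n1) cardsT; exact: card_eq_fintype.
Qed.

End Orbit.

(** * Stabilizers and orbits in the standard representation *)

Section Standard.
Local Open Scope classical_set_scope.
Local Open Scope ring_scope.
Variables (R : realType) (n : nat) (r s : dihedral n).
Hypotheses (n1 : (1 < n)%N) (hrs : dihedral_generators r s).
Variable sigma : mx_representation R [set: dihedral n]%G 2.
Hypothesis hsigma : standard_repr r s sigma.

(** Since s normalizes [<[r]>], the generated group is the product [<[r]> * <[s]>]; the exponents
    then reduce modulo n and 2. *)
Lemma dihedral_elements (g : dihedral n) :
  exists2 i, (i < n)%N & g = (r ^+ i)%g \/ g = (r ^+ i * s)%g.
Proof.
have [gen rn s2 rs] := hrs.
have : g \in (<[r]> * <[s]>)%g.
  rewrite -norm_joinEr; last first.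
    by rewrite norms_cycle rs groupV cycle_id.
  by rewrite joing_idl joing_idr joingE gen inE.
move=> /mulsgP[_ _ /cycleP[i ->] /cycleP[j ->] ->].
exists (i %% n)%N; first by rewrite ltn_mod ltnW.
rewrite -(expg_mod i rn) -(expg_mod j s2) modn2.
by case: (odd j); [right | left; rewrite mulg1].
Qed.

Lemma repr_rotation i : sigma (r ^+ i)%g = rotation_mx (2 * pi * i%:R / n%:R).
Proof.
elim: i => [|i IH]; first by rewrite repr_mx1 mulr0 mul0r rotation_mx0.
rewrite expgS dihedral_reprM IH hsigma.1 -rotation_mxD.
by rewrite -natr1; congr rotation_mx; ring.
Qed.

Lemma repr_rotation_fix (x : 'cV[R]_2) i : x != 0 -> (i < n)%N ->
  sigma (r ^+ i)%g *m x = x -> i = 0%N.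
Proof.
move=> x0 lin; rewrite repr_rotation => /(rotation_mx_fix _ _ _ x0) c1.
apply/eqP; rewrite -leqn0 leqNgt; apply/negP => i0.
(* For 0 < i < n the angle 2 pi i / n lies strictly between 0 and 2 pi, so its cosine cannot be
   1. *)
suff : cos (2 * pi * i%:R / n%:R) < 1 :> R by rewrite c1 ltxx.
have n0 : (0 < n)%N by exact: leq_trans lin.
apply: cos_lt1; rewrite divr_gt0 ?mulr_gt0 ?pi_gt0 ?ltr0n//=.
by rewrite ltr_pdivrMr ?ltr0n// ltr_pM2l ?ltr_nat// mulr_gt0 ?pi_gt0.
Qed.

Lemma dihedral_orbit_ngon (x : 'cV[R]_2) : x != 0 ->
  ~ semiregular_2ngon sigma (dihedral_orbit sigma x) ->
  regular_ngon n (dihedral_orbit sigma x).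
Proof.
move=> x0 nsr.
(* Contrapositive of [free_dihedral_orbit]. *)
have [h hx h1] : exists2 h, sigma h *m x = x & h <> 1%g.
  apply: contrapT => nh; apply/nsr/free_dihedral_orbit => // g gx.
  by apply: contrapT => g1; apply: nh; exists g.
have [i lin [hE|hE]] := dihedral_elements h.
  by case: h1; rewrite hE in hx *; rewrite (repr_rotation_fix x i x0 lin hx).
exists x => //; apply/seteqP; split=> [_ [g _ <-]|_ [k _ <-]]; last first.
  by exists (r ^+ k)%g => //; rewrite repr_rotation.
(* The exponent need not be below n, as it can be reduced modulo n by r^n = 1. *)
suff [k gx] : exists k, sigma g *m x = sigma (r ^+ k)%g *m x.
  have [_ rn _ _] := hrs; exists (k %% n)%N; first by rewrite /= ltn_mod ltnW.
  by rewrite gx -(expg_mod k rn) repr_rotation.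
have [k _ [->|->]] := dihedral_elements g; first by exists k.
(* Here n - i plays the part of -i in the naturals: replacing x by h x with h = r^i s turns the
   right-hand group element into r^(k+n) s = r^k s. *)
exists (k + (n - i))%N; rewrite -[in RHS]hx mulmxA -dihedral_reprM hE.
have [_ rn _ _] := hrs.
by rewrite mulgA -expgD -addnA subnK ?(ltnW lin)// expgD rn mulg1.
Qed.

End Standard.

(** * Sorting the orbits of X into three families *)

Theorem proposition4p1 (R : realType) (n : nat) (hn : 2 <= n)
    (r s : dihedral n) (hrs : dihedral_generators r s)
    (sigma : mx_representation R [set: dihedral n]%G 2)
    (hsigma : standard_repr r s sigma)
    (X : set 'cV[R]_2) (Xfin : finite_set X)
    (Xsym : dihedral_symmetric sigma X)
    (X2 : exists x y : 'cV[R]_2, X x /\ X y /\ x <> y) :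
  exists a b c : nat,
    polygon_decomposition sigma X a b c /\ (a = 0 \/ a = 1) /\ 0 < b + c.
Proof.
pose O := [set dihedral_orbit sigma x | x in X]%classic.
have Of : finite_set O by exact: finite_image.
(* Orbits sharing a point coincide, so disjointness of the pieces will reduce to injectivity of the
   indexing. *)
have eqO S T x : O S -> O T -> S x -> T x -> S = T.
  by move=> [y _ <-] [z _ <-] /dihedral_orbit_eq <- /dihedral_orbit_eq <-.
have sub P : finite_set (O `&` P)%classic by exact: finite_setIl.
(* The orbits are enumerated in three classes, exclusive and exhaustive by their form: the orbit
   {0}, the others that are not semiregular, the others that are. That the second class consists of
   regular n-gons is shown at the end. *)
have [a [Fa [Ia Ra]]] := finite_enum _ _ (sub [set [set 0%R]]%classic).
have [b [Fb [Ib Rb]]] :=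
  finite_enum _ _ (sub [set S | S <> [set 0%R] /\ ~ semiregular_2ngon sigma S]%classic).
have [c [Fc [Ic Rc]]] :=
  finite_enum _ _ (sub [set S | S <> [set 0%R] /\ semiregular_2ngon sigma S]%classic).
have Pa i : (O `&` [set [set 0%R]])%classic (Fa i) by rewrite -Ra; exists i.
have Pb i : (O `&` [set S | S <> [set 0%R] /\ ~ semiregular_2ngon sigma S])%classic (Fb i).
  by rewrite -Rb; exists i.
have Pc i : (O `&` [set S | S <> [set 0%R] /\ semiregular_2ngon sigma S])%classic (Fc i).
  by rewrite -Rc; exists i.
pose F (t : 'I_a + 'I_b + 'I_c) :=
  match t with inl (inl i) => Fa i | inl (inr j) => Fb j | inr k => Fc k end.
have OF t : O (F t).
  by case: t => [[i|j]|k]; [have [] := Pa i | have [] := Pb j | have [] := Pc k].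
have surjF S : O S -> exists t, F t = S.
  move=> OS; have [S0|S0] := pselect (S = [set 0%R]%classic).
    have : range Fa S by rewrite Ra.
    by case=> i _ <-; exists (inl (inl i)).
  have [sr|sr] := pselect (semiregular_2ngon sigma S).
    have : range Fc S by rewrite Rc.
    by case=> k _ <-; exists (inr k).
  have : range Fb S by rewrite Rb.
  by case=> j _ <-; exists (inl (inr j)).
(* Within a family the enumeration is injective; across families the defining conditions contradict
   each other. *)
have injF t u : F t = F u -> t = u.
  case: t u => [[i|j]|k] [[i'|j']|k'] //= e.
  - by rewrite (Ia _ _ e).
  - by have [_ []] := Pb j'; rewrite -e; have [_ ->] := Pa i.
  - by have [_ []] := Pc k'; rewrite -e; have [_ ->] := Pa i.
  - by have [_ []] := Pb j; rewrite e; have [_ ->] := Pa i'.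
  - by rewrite (Ib _ _ e).
  - by have [_ [_]] := Pb j; rewrite e; have [_ [_]] := Pc k'.
  - by have [_ []] := Pc k; rewrite e; have [_ ->] := Pa i'.
  - by have [_ [_]] := Pb j'; rewrite -e; have [_ [_]] := Pc k.
  - by rewrite (Ic _ _ e).
exists a, b, c; split; [exists F; split|split].
- apply/seteqP; split=> [x Xx|x [t _ Ftx]].
    have [|t Ft] := surjF (dihedral_orbit sigma x); first by exists x.
    by exists t => //; rewrite Ft; exact: dihedral_orbit_refl.
  have [y Xy yF] := OF t.
  by apply: (dihedral_orbit_sub _ _ _ _ _ Xsym Xy); rewrite yF.
- move=> t u _ _ [x [Ftx Fux]]; apply: injF.
  exact: (eqO _ _ x (OF t) (OF u)).
- by move=> t; have [x _ <-] := OF t; exact: dihedral_orbit_sym.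
- split=> [i|j|k]; last by have [_ []] := Pc k.
    by exists 0%R; have [] := Pa i.
  have [[x Xx xF] [F0 nsr]] := Pb j.
  rewrite -xF in F0 nsr; rewrite [F _]/= -xF.
  apply: (dihedral_orbit_ngon _ _ _ _ hn hrs _ hsigma) => //.
  by apply/eqP => x0; apply: F0; rewrite x0 dihedral_orbit0.
(* Indices 1 and 0 of ['I_a] would both name the orbit {0}, against injectivity of [Fa]. *)
- have : a <= 1.
    rewrite leqNgt; apply/negP => a1.
    have : Ordinal a1 = Ordinal (ltnW a1).
      by apply: Ia; have [_ ->] := Pa (Ordinal a1); have [_ ->] := Pa (Ordinal (ltnW a1)).
    by case.
  by case: a {Fa Ia Ra Pa F OF surjF injF} => [|[|]]; auto.
(* Of two distinct points one is nonzero. Its orbit is not {0}, so its index lies in ['I_b] or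
   ['I_c], which is therefore inhabited. *)
have [x [Xx x0]] : exists x, X x /\ x <> 0%R.
  have [x [y [Xx [Xy xy]]]] := X2.
  have [x0|x0] := pselect (x = 0%R); last by exists x.
  by exists y; split=> // y0; apply: xy; rewrite x0 y0.
have [|t Ft] := surjF (dihedral_orbit sigma x); first by exists x.
case: t Ft => [[i|j]|k] /= Ft.
- case: x0; have [_ F0] := Pa i.
  by have := dihedral_orbit_refl _ _ sigma x; rewrite -Ft F0.
- by rewrite addn_gt0 (leq_ltn_trans _ (ltn_ord j)).
- by rewrite addn_gt0 (leq_ltn_trans _ (ltn_ord k)) ?orbT.
Qed.
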